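(* The logic $\mathcal L(\mathbb V(\mathbf L_1^{dm},\mathbf L_1^{dp},\mathbf L_3^{dm},\mathbf L_3^{dp},\mathbf D_2))$ is defined, as an axiomatic extension of the logic $\mathcal{RDQDS}\mathrm{t}\mathcal{SH}_1$, by $$[(\alpha\to\beta)\to(\bot\to\beta)]\Leftrightarrow_H[(\alpha\to\beta)\to\top].$$
   Context: Language: $\langle\vee,\wedge,\to,\sim,\bot,\top\rangle$ of arities $2,2,2,1,0,0$. $\alpha\to_H\beta$ abbreviates $\alpha\to(\alpha\wedge\beta)$ and $\alpha\Leftrightarrow_H\beta$ abbreviates $(\alpha\to_H\beta)\wedge(\beta\to_H\alpha)$. The logic $\mathcal{DHMSH}$ is the Hilbert-style logic with axiom schemes: (A1) $\alpha\to_H(\alpha\vee\beta)$; (A2) $\beta\to_H(\alpha\vee\beta)$; (A3) $(\alpha\to_H\gamma)\to_H[(\beta\to_H\gamma)\to_H((\alpha\vee\beta)\to_H\gamma)]$; (A4) $(\alpha\wedge\beta)\to_H\alpha$; (A5) $(\gamma\to_H\alpha)\to_H[(\gamma\to_H\beta)\to_H(\gamma\to_H(\alpha\wedge\beta))]$; (A6) $\top$; (A7) $\bot\to_H\alpha$; (A8) $((\alpha\wedge\beta)\to_H\gamma)\to_H(\alpha\to_H(\beta\to_H\gamma))$; (A9) $(\alpha\to_H(\beta\to_H\gamma))\to_H((\alpha\wedge\beta)\to_H\gamma)$; (A10) $(\alpha\to_H\beta)\to_H((\beta\to_H\alpha)\to_H((\alpha\to\gamma)\to_H(\beta\to\gamma)))$;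 (A11) $(\alpha\to_H\beta)\to_H((\beta\to_H\alpha)\to_H((\gamma\to\beta)\to_H(\gamma\to\alpha)))$; (A12) $\top\to_H{\sim}\bot$; (A13) ${\sim}\top\to_H\bot$; (A14) ${\sim}(\alpha\wedge\beta)\to_H({\sim}\alpha\vee{\sim}\beta)$; and rules (SMP): from $\phi$ and $\phi\to_H\gamma$ deduce $\gamma$; (SCP): from $\phi\to_H\gamma$ deduce ${\sim}\gamma\to_H{\sim}\phi$ (both applicable to any formulas derived from the premises). An axiomatic extension is obtained by adjoining new axiom schemes and keeping the same rules. A semi-Heyting algebra is an algebra $\langle L,\vee,\wedge,\to,0,1\rangle$ such that $\langle L,\vee,\wedge,0,1\rangle$ is a lattice with $0$ and $1$, and $x\wedge(x\to y)\approx x\wedge y$, $x\wedge(y\to z)\approx x\wedge[(x\wedge y)\to(x\wedge z)]$, $x\to x\approx1$. $\mathbb{DHMSH}$ is the variety of algebras $\langle A,\vee,\wedge,\to,{}',0,1\rangle$ such that $\langle A,\vee,\wedge,\to,0,1\rangle$ is a semi-Heyting algebra and $0'\approx1$, $1'\approx0$, $(x\wedge y)'\approx x'\vee y'$. Formulas are interpreted with $\sim,\bot,\top$ as ${}',0,1$. Put $x^*:=x\to0$ and $x^+:=((x')^* )'$. $\mathbb{DQDSH}$ is the subvariety of $\mathbb{DHMSH}$ defined by $(x\vee y)''\approx x''\vee y''$, $x'''\approx x'$, $x''\le x$. $\mathbb{RDQDS}\mathrm{t}\mathbb{SH}_1$ is the subvariety of $\mathbb{DQDSH}$ defined by: regularity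 $x\wedge x^+\le y\vee y^*$; the Stone identity $x^*\vee x^{**}\approx1$; and level 1: $x\wedge x'^*\approx x\wedge x'^*\wedge x'^*{}'^*$ (unary operations composed from left to right). The logic corresponding to a subvariety $\mathbb V$ of $\mathbb{DHMSH}$, denoted $\mathcal L(\mathbb V)$, is the unique axiomatic extension $\mathcal E$ of $\mathcal{DHMSH}$ such that $\mathbb V=\{\mathbf A\in\mathbb{DHMSH}:\mathbf A\models\delta\approx1\text{ for every theorem }\delta\text{ of }\mathcal E\}$. $\mathcal{RDQDS}\mathrm{t}\mathcal{SH}_1$ is the logic corresponding to $\mathbb{RDQDS}\mathrm{t}\mathbb{SH}_1$. $\mathbf L_1,\mathbf L_3$ are semi-Heyting algebras on the chain $0<a<1$ with $0\to x=1$ for all $x$, $a\to0=0$, $a\to a=1$, $1\to0=0$, $1\to a=a$, $1\to1=1$, and $a\to1=1$ in $\mathbf L_1$, $a\to1=a$ in $\mathbf L_3$. $\mathbf L_i^{dm}$ (resp. $\mathbf L_i^{dp}$) is the expansion of $\mathbf L_i$ by ${}'$ with $0'=1$, $1'=0$ and $a'=a$ (resp. $a'=1$). $\mathbf D_2$ is the four-element Boolean lattice $\{0,a,b,1\}$ with Boolean implication $x\to y=x^c\vee y$ ($x^c$ the Boolean complement) and $0'=1$, $1'=0$, $a'=a$, $b'=b$. $\mathbb V(\cdot)$ denotes the generated variety. *)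

(* Defs.v *)
(* Only the Rocq prelude is used.  Algebras are raw structures for the language
   <join, meet, imp, prime, 0, 1>; classes of algebras are predicates on them. *)

Set Implicit Arguments.
Unset Strict Implicit.

Inductive formula : Type :=
| Var (n : nat)
| Or (a b : formula)
| And (a b : formula)
| Imp (a b : formula)
| Neg (a : formula)
| Bot
| Top.

Declare Scope formula_scope.
Delimit Scope formula_scope with F.
Bind Scope formula_scope with formula.

Definition ImpH (a b : formula) : formula := Imp a (And a b).
Definition IffH (a b : formula) : formula := And (ImpH a b) (ImpH b a).

Notation "a ∨ b" := (Or a b) (at level 50, left associativity) : formula_scope.
Notation "a ∧ b" := (And a b) (at level 40, left associativity) : formula_scope.
Notation "a → b" := (Imp a b) (at level 65, right associativity) : formula_scope.
Notation "a →H b" := (ImpH a b) (at level 65, right associativity) : formula_scope.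
Notation "a ⇔H b" := (IffH a b) (at level 66, no associativity) : formula_scope.
Notation "∼ a" := (Neg a) (at level 35, right associativity) : formula_scope.
Notation "⊥" := Bot : formula_scope.
Notation "⊤" := Top : formula_scope.

Fixpoint subst (s : nat -> formula) (a : formula) : formula :=
  match a with
  | Var n => s n
  | Or b c => Or (subst s b) (subst s c)
  | And b c => And (subst s b) (subst s c)
  | Imp b c => Imp (subst s b) (subst s c)
  | Neg b => Neg (subst s b)
  | Bot => Bot
  | Top => Top
  end.

Section Logics.
Local Open Scope formula_scope.

Inductive DHMSH_axiom : formula -> Prop :=
| A1 a b : DHMSH_axiom (a →H (a ∨ b))
| A2 a b : DHMSH_axiom (b →H (a ∨ b))
| A3 a b c : DHMSH_axiom ((a →H c) →H ((b →H c) →H ((a ∨ b) →H c)))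
| A4 a b : DHMSH_axiom ((a ∧ b) →H a)
| A5 a b c : DHMSH_axiom ((c →H a) →H ((c →H b) →H (c →H (a ∧ b))))
| A6 : DHMSH_axiom ⊤
| A7 a : DHMSH_axiom (⊥ →H a)
| A8 a b c : DHMSH_axiom (((a ∧ b) →H c) →H (a →H (b →H c)))
| A9 a b c : DHMSH_axiom ((a →H (b →H c)) →H ((a ∧ b) →H c))
| A10 a b c : DHMSH_axiom ((a →H b) →H ((b →H a) →H ((a → c) →H (b → c))))
| A11 a b c : DHMSH_axiom ((a →H b) →H ((b →H a) →H ((c → b) →H (c → a))))
| A12 : DHMSH_axiom (⊤ →H (∼ ⊥))
| A13 : DHMSH_axiom ((∼ ⊤) →H ⊥)
| A14 a b : DHMSH_axiom ((∼ (a ∧ b)) →H ((∼ a) ∨ (∼ b))).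

(* An axiomatic extension of DHMSH is presented by the set of axiom schemes it
   adjoins.  A scheme is a formula whose variables act as metavariables: all its
   substitution instances are axioms. *)
Definition schemes := formula -> Prop.

Inductive derivable (E : schemes) (G : formula -> Prop) : formula -> Prop :=
| D_premise a : G a -> derivable E G a
| D_base a : DHMSH_axiom a -> derivable E G a
| D_scheme a s : E a -> derivable E G (subst s a)
| D_SMP a b : derivable E G a -> derivable E G (a →H b) -> derivable E G b
| D_SCP a b : derivable E G (a →H b) -> derivable E G ((∼ b) →H (∼ a)).

Definition is_theorem (E : schemes) (a : formula) : Prop :=
  derivable E (fun _ => False) a.

Definition same_logic (E1 E2 : schemes) : Prop :=
  forall G a, derivable E1 G a <-> derivable E2 G a.

Definition adjoin (E N : schemes) : schemes := fun a => E a \/ N a.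

End Logics.

Record algebra : Type := Algebra {
  carrier :> Type;
  join : carrier -> carrier -> carrier;
  meet : carrier -> carrier -> carrier;
  imp : carrier -> carrier -> carrier;
  prime : carrier -> carrier;
  zero : carrier;
  one : carrier
}.

Arguments zero {a}.
Arguments one {a}.

Fixpoint eval (A : algebra) (v : nat -> A) (a : formula) : A :=
  match a with
  | Var n => v n
  | Or b c => join (eval v b) (eval v c)
  | And b c => meet (eval v b) (eval v c)
  | Imp b c => imp (eval v b) (eval v c)
  | Neg b => prime (eval v b)
  | Bot => zero
  | Top => one
  end.

Definition valid (A : algebra) (a : formula) : Prop :=
  forall v : nat -> A, eval v a = one.

Definition is_hom (A B : algebra) (f : A -> B) : Prop :=
  (forall x y, f (join x y) = join (f x) (f y)) /\
  (forall x y, f (meet x y) = meet (f x) (f y)) /\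
  (forall x y, f (imp x y) = imp (f x) (f y)) /\
  (forall x, f (prime x) = prime (f x)) /\
  f zero = zero /\
  f one = one.

Definition product (I : Type) (A : I -> algebra) : algebra :=
  @Algebra (forall i, A i)
    (fun x y i => join (x i) (y i))
    (fun x y i => meet (x i) (y i))
    (fun x y i => imp (x i) (y i))
    (fun x i => prime (x i))
    (fun _ => zero)
    (fun _ => one).

Definition class := algebra -> Prop.

Definition closed_H (V : class) : Prop :=
  forall (A B : algebra) (f : A -> B),
    is_hom f -> (forall y, exists x, f x = y) -> V A -> V B.

(* Closure under isomorphic copies of subalgebras, i.e. domains of embeddings. *)
Definition closed_S (V : class) : Prop :=
  forall (A B : algebra) (f : B -> A),
    is_hom f -> (forall x y, f x = f y -> x = y) -> V A -> V B.

Definition closed_P (V : class) : Prop :=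
  forall (I : Type) (A : I -> algebra), (forall i, V (A i)) -> V (product A).

Definition is_variety (V : class) : Prop :=
  closed_H V /\ closed_S V /\ closed_P V.

Definition generated_variety (K : class) : class :=
  fun A => forall V : class, is_variety V -> (forall B, K B -> V B) -> V A.

Section Identities.
Variable A : algebra.
Implicit Types x y z : A.

Definition le x y : Prop := meet x y = x.
Definition star x : A := imp x zero.
Definition plus x : A := prime (star (prime x)).

Definition bounded_lattice : Prop :=
  (forall x y, join x y = join y x) /\
  (forall x y, meet x y = meet y x) /\
  (forall x y z, join x (join y z) = join (join x y) z) /\
  (forall x y z, meet x (meet y z) = meet (meet x y) z) /\
  (forall x y, join x (meet x y) = x) /\
  (forall x y, meet x (join x y) = x) /\
  (forall x, le zero x) /\
  (forall x, le x one).

Definition semi_Heyting : Prop :=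
  bounded_lattice /\
  (forall x y, meet x (imp x y) = meet x y) /\
  (forall x y z, meet x (imp y z) = meet x (imp (meet x y) (meet x z))) /\
  (forall x, imp x x = one).

Definition DHMSH : Prop :=
  semi_Heyting /\
  prime (@zero A) = one /\
  prime (@one A) = zero /\
  (forall x y, prime (meet x y) = join (prime x) (prime y)).

Definition DQDSH : Prop :=
  DHMSH /\
  (forall x y, prime (prime (join x y)) =
               join (prime (prime x)) (prime (prime y))) /\
  (forall x, prime (prime (prime x)) = prime x) /\
  (forall x, le (prime (prime x)) x).

Definition regular : Prop :=
  forall x y, le (meet x (plus x)) (join y (star y)).

Definition Stone : Prop :=
  forall x, join (star x) (star (star x)) = one.

Definition level1 : Prop :=
  forall x, meet x (star (prime x)) =
            meet (meet x (star (prime x)))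
                 (star (prime (star (prime x)))).

Definition RDQDStSH1 : Prop := DQDSH /\ regular /\ Stone /\ level1.

End Identities.

Definition corresponds (E : schemes) (V : class) : Prop :=
  forall A : algebra,
    V A <-> DHMSH A /\ (forall a, is_theorem E a -> valid A a).

(* E presents the logic L(V): among the axiomatic extensions of DHMSH, it is the
   unique one, up to equality of consequence relations, corresponding to V. *)
Definition is_logic_of (E : schemes) (V : class) : Prop :=
  corresponds E V /\ (forall E', corresponds E' V -> same_logic E' E).

Inductive chain3 : Type := c0 | ca | c1.

Definition join3 (x y : chain3) : chain3 :=
  match x, y with
  | c0, z | z, c0 => z
  | c1, _ | _, c1 => c1
  | ca, ca => ca
  end.

Definition meet3 (x y : chain3) : chain3 :=
  match x, y with
  | c1, z | z, c1 => z
  | c0, _ | _, c0 => c0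
  | ca, ca => ca
  end.

Definition imp_L1 (x y : chain3) : chain3 :=
  match x, y with
  | c0, _ => c1
  | ca, c0 => c0
  | ca, ca => c1
  | ca, c1 => c1
  | c1, _ => y
  end.

Definition imp_L3 (x y : chain3) : chain3 :=
  match x, y with
  | c0, _ => c1
  | ca, c0 => c0
  | ca, ca => c1
  | ca, c1 => ca
  | c1, _ => y
  end.

Definition prime_dm (x : chain3) : chain3 :=
  match x with c0 => c1 | ca => ca | c1 => c0 end.

Definition prime_dp (x : chain3) : chain3 :=
  match x with c0 => c1 | ca => c1 | c1 => c0 end.

Definition L1dm : algebra := Algebra join3 meet3 imp_L1 prime_dm c0 c1.
Definition L1dp : algebra := Algebra join3 meet3 imp_L1 prime_dp c0 c1.
Definition L3dm : algebra := Algebra join3 meet3 imp_L3 prime_dm c0 c1.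
Definition L3dp : algebra := Algebra join3 meet3 imp_L3 prime_dp c0 c1.

(* The four-element Boolean lattice as bool * bool, with atoms a = (true, false)
   and b = (false, true). *)
Definition prime_D2 (x : bool * bool) : bool * bool :=
  match x with
  | (false, false) => (true, true)
  | (true, true) => (false, false)
  | (true, false) => (true, false)
  | (false, true) => (false, true)
  end.

Definition D2 : algebra :=
  @Algebra (bool * bool)
    (fun x y => (orb (fst x) (fst y), orb (snd x) (snd y)))
    (fun x y => (andb (fst x) (fst y), andb (snd x) (snd y)))
    (fun x y => (orb (negb (fst x)) (fst y), orb (negb (snd x)) (snd y)))
    prime_D2
    (false, false)
    (true, true).

Definition five_algebras : class :=
  fun A => A = L1dm \/ A = L1dp \/ A = L3dm \/ A = L3dp \/ A = D2.

(* Main.v *)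
Require Import Defs.
From Stdlib Require Import List.
From mathcomp Require boolp classical_sets.

Set Implicit Arguments.
Unset Strict Implicit.

(** Two facts combine.

    The logical one: every axiomatic extension [E] has, for each set [G] of premises,
    a Lindenbaum algebra [lind E G] of formulas modulo provable equivalence
    ([lind_DHMSH]).  It validates [E], and its unit is the class of the formulas
    derivable from [G].  Hence two extensions with the same models have the same
    consequence relation ([derivable_models]), and presenting the logic of a class
    amounts to axiomatizing that class ([is_logic_of_corresponds]).  In an algebra of
    [DHMSH] the identity [s = t] amounts to the validity of [IffH s t], so the
    identities of [RDQDStSH1] present its logic.

    The algebraic one: for [alpha = beta] the new scheme says [0 ⇒ y = 1], and
    conversely [0 ⇒ y = 1] implies it.  So the claim is that an algebra of [RDQDStSH1]
    with [0 ⇒ y = 1] embeds into a product of copies of the five generators ([homs_separate]).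
    Distinct points are separated by a prime filter [P].  By the Stone identity [P] lies
    in a unique maximal filter [M = maxf P], the set of all [x] with [x*] outside [P];
    let [polar P] be the set of all [x] with [x'] outside [P].

    If [P] differs from [M], regularity gives [polar (polar P) = P] and level 1
    then forces [polar M = P], with [polar P] equal to [P] or to [M]
    ([polar_nonmaximal]).  Regularity also identifies all elements of [M] outside [P]
    modulo the filter [P] ([middle_le]).  Therefore sending [P] to 1, the rest of [M] to
    [a] and everything else to 0 is a homomorphism to a three-element chain, whose
    [prime] is of type dp or dm accordingly; and [a ⇒ 1] is 1 or [a], whence
    [L1] or [L3].

    If [P] is maximal, either some non-maximal prime filter lies below it and the
    previous case applies, or [P] and [polar P] are maximal filters exchanged by [polar],
    and the pair of their characteristic functions is a homomorphism to [D2]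
    ([prime_represented]). *)

Local Notation "x ⊔ y" := (join x y) (at level 50, left associativity).
Local Notation "x ⊓ y" := (meet x y) (at level 40, left associativity).
Local Notation "x ⇒ y" := (imp x y) (at level 55, right associativity).
Local Notation "x ≤ y" := (le x y) (at level 70, no associativity).

(** * Semi-Heyting algebras *)

Section SemiHeyting.
Context (A : algebra) (HA : semi_Heyting A).
Implicit Types x y z w p : A.

Lemma joinC x y : x ⊔ y = y ⊔ x. Proof. apply HA. Qed.
Lemma meetC x y : x ⊓ y = y ⊓ x. Proof. apply HA. Qed.
Lemma joinA x y z : x ⊔ (y ⊔ z) = x ⊔ y ⊔ z. Proof. apply HA. Qed.
Lemma meetA x y z : x ⊓ (y ⊓ z) = x ⊓ y ⊓ z. Proof. apply HA. Qed.
Lemma join_meetK x y : x ⊔ x ⊓ y = x. Proof. apply HA. Qed.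
Lemma meet_joinK x y : x ⊓ (x ⊔ y) = x. Proof. apply HA. Qed.
Lemma zero_le x : zero ≤ x. Proof. apply HA. Qed.
Lemma le_one x : x ≤ one. Proof. apply HA. Qed.
Lemma meet_imp x y : x ⊓ (x ⇒ y) = x ⊓ y. Proof. apply HA. Qed.
Lemma meet_imp_rel x y z : x ⊓ (y ⇒ z) = x ⊓ ((x ⊓ y) ⇒ (x ⊓ z)).
Proof. apply HA. Qed.
Lemma impxx x : x ⇒ x = one. Proof. apply HA. Qed.

Lemma le_refl x : x ≤ x.
Proof. pose proof (meet_joinK x (x ⊓ x)) as H; now rewrite join_meetK in H. Qed.

Lemma le_trans y x z : x ≤ y -> y ≤ z -> x ≤ z.
Proof. unfold le; intros H1 H2; now rewrite <- H1, <- meetA, H2. Qed.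

Lemma le_antisym x y : x ≤ y -> y ≤ x -> x = y.
Proof. unfold le; intros H1 H2; now rewrite <- H1, meetC. Qed.

Lemma meet_le_r x y z : y ≤ z -> x ⊓ y ≤ z.
Proof. unfold le; intros H; now rewrite <- meetA, H. Qed.

Lemma meet_le_l x y z : x ≤ z -> x ⊓ y ≤ z.
Proof. rewrite meetC; apply meet_le_r. Qed.

Lemma le_meet x y z : z ≤ x -> z ≤ y -> z ≤ x ⊓ y.
Proof. unfold le; intros H1 H2; now rewrite meetA, H1. Qed.

Lemma le_join_l x y : x ≤ x ⊔ y. Proof. apply meet_joinK. Qed.
Lemma le_join_r x y : y ≤ x ⊔ y. Proof. rewrite joinC; apply meet_joinK. Qed.

Lemma le_join_le_l x y z : x ≤ y -> x ≤ y ⊔ z.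
Proof. intros H; apply (le_trans H), le_join_l. Qed.

Lemma le_join_le_r x y z : x ≤ z -> x ≤ y ⊔ z.
Proof. intros H; apply (le_trans H), le_join_r. Qed.

Lemma le_join_eq x y : x ≤ y <-> x ⊔ y = y.
Proof.
split; intros H.
- rewrite <- H, (meetC x y), joinC; apply join_meetK.
- rewrite <- H; apply le_join_l.
Qed.

Lemma join_le x y z : x ≤ z -> y ≤ z -> x ⊔ y ≤ z.
Proof. rewrite !le_join_eq; intros H1 H2; now rewrite <- joinA, H2. Qed.

Lemma one_le x : one ≤ x <-> x = one.
Proof.
split; intros H; [apply le_antisym; auto using le_one | rewrite H; apply le_refl].
Qed.

Lemma le_zero x : x ≤ zero <-> x = zero.
Proof.
split; intros H; [apply le_antisym; auto using zero_le | rewrite H; apply le_refl].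
Qed.

Lemma meet1x x : one ⊓ x = x. Proof. rewrite meetC; apply le_one. Qed.

Lemma le_eq x y : x = y -> x ≤ y. Proof. intros ->; apply le_refl. Qed.

(** The term defining [ImpH] is the relative pseudocomplement of the lattice,
    so that every semi-Heyting algebra carries a Heyting algebra. *)
Lemma residuation z x y : z ⊓ x ≤ y <-> z ≤ (x ⇒ (x ⊓ y)).
Proof.
split; intros H.
- unfold le; rewrite meet_imp_rel, meetA, H, impxx; apply le_one.
- apply le_trans with (x ⊓ (x ⇒ (x ⊓ y))).
  + rewrite (meetC z); apply le_meet; [apply meet_le_l, le_refl|].
    now apply meet_le_r.
  + rewrite meet_imp; apply meet_le_r, meet_le_r, le_refl.
Qed.

Lemma imp_meet_one x y : (x ⇒ (x ⊓ y)) = one <-> x ≤ y.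
Proof. rewrite <- one_le, <- residuation, meet1x; reflexivity. Qed.

Lemma iffH_one x y : (x ⇒ (x ⊓ y)) ⊓ (y ⇒ (y ⊓ x)) = one <-> x = y.
Proof.
split.
- intros H; apply le_antisym; apply imp_meet_one, one_le; rewrite <- H.
  + apply meet_le_l, le_refl.
  + apply meet_le_r, le_refl.
- intros ->; rewrite (proj2 (imp_meet_one y y) (le_refl y)); apply le_refl.
Qed.

Lemma meet_join_le x y z w : x ⊓ y ≤ w -> x ⊓ z ≤ w -> x ⊓ (y ⊔ z) ≤ w.
Proof.
rewrite !(meetC x), !residuation; apply join_le.
Qed.

Lemma meet_imp_congr p x y x' y' :
  p ⊓ x = p ⊓ x' -> p ⊓ y = p ⊓ y' -> p ⊓ (x ⇒ y) = p ⊓ (x' ⇒ y').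
Proof. intros H1 H2; now rewrite meet_imp_rel, H1, H2, <- meet_imp_rel. Qed.

Lemma le_star x z : z ≤ star x <-> x ⊓ z = zero.
Proof.
split; intros H.
- apply le_zero, le_trans with (x ⊓ star x).
  + apply le_meet; [apply meet_le_l, le_refl | now apply meet_le_r].
  + unfold star; rewrite meet_imp; apply meet_le_r, le_refl.
- unfold le, star; rewrite meet_imp_rel, (meetC z x), H, (meetC z zero), zero_le.
  rewrite impxx; apply le_one.
Qed.

Lemma meet_star x : x ⊓ star x = zero.
Proof. apply le_star, le_refl. Qed.

Lemma star_zero : star zero = one :> A. Proof. apply impxx. Qed.

Lemma star_one : star one = zero :> A.
Proof. rewrite <- (meet1x (star one)); apply meet_star. Qed.

Lemma star_le x y : x ≤ y -> star y ≤ star x.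
Proof.
intros H; apply le_star, le_zero; rewrite <- (meet_star y).
apply le_meet; [now apply meet_le_l | apply meet_le_r, le_refl].
Qed.

End SemiHeyting.

#[local] Hint Resolve le_refl meet_le_l meet_le_r le_meet le_join_le_l le_join_le_r
  join_le zero_le le_one : lat.

Lemma DHMSH_semi_Heyting (A : algebra) : DHMSH A -> semi_Heyting A.
Proof. now intros []. Qed.
#[local] Hint Resolve DHMSH_semi_Heyting : lat.

Lemma prime_le (A : algebra) (HA : DHMSH A) (x y : A) :
  x ≤ y -> prime y ≤ prime x.
Proof.
destruct HA as (HS & _ & _ & H); intros Hxy.
apply le_join_eq; trivial; rewrite joinC, <- H; trivial; now rewrite Hxy.
Qed.

(** * Soundness *)

Lemma DHMSH_axiom_valid (A : algebra) (HA : DHMSH A) a :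
  DHMSH_axiom a -> valid A a.
Proof.
pose proof (DHMSH_semi_Heyting HA) as HS.
intros Ha v; destruct Ha; cbn;
  repeat (rewrite imp_meet_one by trivial); rewrite <- ?residuation by trivial.
- auto with lat.
- auto with lat.
- apply meet_join_le; trivial.
  + apply residuation; auto with lat.
  + apply residuation; auto with lat.
- auto with lat.
- apply le_meet; trivial; apply residuation; auto with lat.
- reflexivity.
- auto with lat.
- rewrite <- meetA; trivial; apply residuation; auto with lat.
- rewrite meetA; trivial; do 2 (apply residuation; trivial); auto with lat.
- set (w := meet _ (eval v a ⇒ eval v c)).
  enough (Hw : w ⊓ eval v a = w ⊓ eval v b).
  { unfold le; rewrite <- (meet_imp_congr HS Hw (eq_refl (w ⊓ eval v c))).
    change (w ≤ (eval v a ⇒ eval v c)); unfold w; auto with lat. }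
  apply le_antisym; trivial; apply le_meet; auto with lat;
    apply residuation; unfold w; auto with lat.
- set (w := meet _ (eval v c ⇒ eval v b)).
  enough (Hw : w ⊓ eval v b = w ⊓ eval v a).
  { unfold le; rewrite <- (meet_imp_congr HS (eq_refl (w ⊓ eval v c)) Hw).
    change (w ≤ (eval v c ⇒ eval v b)); unfold w; auto with lat. }
  apply le_antisym; trivial; apply le_meet; auto with lat;
    apply residuation; unfold w; auto with lat.
- apply le_eq; trivial; symmetry; apply HA.
- apply le_eq; trivial; apply HA.
- apply le_eq; trivial; apply HA.
Qed.

Lemma eval_subst (A : algebra) (v : nat -> A) s a :
  eval v (subst s a) = eval (fun n => eval v (s n)) a.
Proof. induction a; cbn; congruence. Qed.

Lemma subst_Var a : subst Var a = a.
Proof. induction a; cbn; congruence. Qed.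

(** The algebras of the variety that corresponds to [E]. *)
Definition models (E : schemes) : class :=
  fun A => DHMSH A /\ forall a, E a -> valid A a.

Lemma theorem_valid E A a : models E A -> is_theorem E a -> valid A a.
Proof.
intros [HA HE] Ha.
pose proof (DHMSH_semi_Heyting HA) as HS.
induction Ha as [a []|a Ha|a s Ha|a b _ IHa _ IHab|a b _ IHab]; intros v.
- now apply DHMSH_axiom_valid.
- rewrite eval_subst; now apply HE.
- apply one_le; trivial; rewrite <- (IHa v).
  apply imp_meet_one; trivial; apply (IHab v).
- cbn; apply imp_meet_one; trivial; apply prime_le; trivial.
  apply imp_meet_one; trivial; apply (IHab v).
Qed.

Lemma corresponds_models E V : corresponds E V <-> forall A, V A <-> models E A.
Proof.
enough (H : forall A, models E A <->
                      DHMSH A /\ (forall a, is_theorem E a -> valid A a)).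
{ unfold corresponds; split; intros HV A; rewrite HV, H; reflexivity. }
intros A; split.
- intros HA; split; [apply HA|]; intros a; now apply theorem_valid.
- intros [HA HE]; split; trivial; intros a Ha; apply HE.
  rewrite <- (subst_Var a); now apply D_scheme.
Qed.

(** * The Lindenbaum algebra *)

Section Lindenbaum.
Context (E : schemes) (G : formula -> Prop).
Local Open Scope formula_scope.
Local Notation "⊢ a" := (derivable E G a%F) (at level 70).
Implicit Types a b c d x y z w s t : formula.

Lemma mp a b : ⊢ a →H b -> ⊢ a -> ⊢ b.
Proof. intros H Ha; exact (D_SMP Ha H). Qed.

Lemma weaken_axiom a b : ⊢ a →H (b →H a).
Proof. eapply mp; apply D_base; [apply A8|apply A4]. Qed.

Lemma weaken b a : ⊢ a -> ⊢ b →H a.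
Proof. apply mp, weaken_axiom. Qed.

Lemma curry a b c : ⊢ (a ∧ b) →H c -> ⊢ a →H (b →H c).
Proof. apply mp, D_base, A8. Qed.

Lemma uncurry a b c : ⊢ a →H (b →H c) -> ⊢ (a ∧ b) →H c.
Proof. apply mp, D_base, A9. Qed.

Lemma and_intro a b c : ⊢ c →H a -> ⊢ c →H b -> ⊢ c →H (a ∧ b).
Proof. intros H; apply mp; revert H; apply mp, D_base, A5. Qed.

Lemma and_l a b : ⊢ (a ∧ b) →H a.
Proof. apply D_base, A4. Qed.

Lemma imp_congr_l a b c : ⊢ a →H b -> ⊢ b →H a -> ⊢ a → c -> ⊢ b → c.
Proof. intros H1 H2; apply mp; revert H2; apply mp; revert H1; apply mp, D_base, A10. Qed.

Lemma imp_congr_r a b c : ⊢ a →H b -> ⊢ b →H a -> ⊢ c → b -> ⊢ c → a.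
Proof. intros H1 H2; apply mp; revert H2; apply mp; revert H1; apply mp, D_base, A11. Qed.

Lemma impH_refl a : ⊢ a →H a.
Proof.
(* [a →H (a →H a)] is [a → (a ∧ (a →H a))], and its conclusion can be exchanged
   for the equivalent [a ∧ a]. *)
assert (H : ⊢ a ∧ (a →H a) →H a ∧ a) by (apply and_intro; apply and_l).
refine (imp_congr_r _ H (weaken_axiom a a)).
apply and_intro; [apply and_l | apply uncurry, weaken, weaken_axiom].
Qed.

Lemma and_r a b : ⊢ (a ∧ b) →H b.
Proof. apply uncurry, weaken, impH_refl. Qed.

Lemma and_weaken_r c a b : ⊢ a →H b -> ⊢ (c ∧ a) →H b.
Proof. intros H; apply uncurry, weaken, H. Qed.

(** Transitivity, first for a second step that is an equivalence: this case is what
    the projections out of nested conjunctions, hence [and_weaken_l], need. *)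
Lemma impH_trans_equiv x s t :
  ⊢ x →H s -> ⊢ s →H t -> ⊢ t →H s -> ⊢ x →H t.
Proof.
intros Hx Hst Hts; refine (imp_congr_r _ _ Hx);
  (apply and_intro; [apply and_l | now apply and_weaken_r]).
Qed.

Lemma and_ll a b c : ⊢ ((a ∧ b) ∧ c) →H a.
Proof.
apply uncurry, uncurry, impH_trans_equiv with ((b ∧ c) →H a).
- apply weaken_axiom.
- apply D_base, A8.
- apply D_base, A9.
Qed.

Lemma and_lr a b c : ⊢ ((a ∧ b) ∧ c) →H b.
Proof. apply uncurry, and_weaken_r, weaken_axiom. Qed.

Lemma and_weaken_l x w y : ⊢ x →H y -> ⊢ (x ∧ w) →H y.
Proof.
intros H.
(* [(w ∧ x) →H y] holds; both [w ∧ x] in it are exchanged for [x ∧ w]. *)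
refine (imp_congr_r (b := (w ∧ x) ∧ y) _ _ (imp_congr_l _ _ (and_weaken_r w H)));
  repeat apply and_intro; auto using and_l, and_r, and_ll, and_lr.
Qed.

Lemma impH_trans y x z : ⊢ x →H y -> ⊢ y →H z -> ⊢ x →H z.
Proof.
intros Hx Hy; refine (imp_congr_r _ _ Hx);
  (apply and_intro; [apply and_l|]).
- now apply and_weaken_l.
- now apply and_weaken_r.
Qed.

Lemma impH_mp w x y : ⊢ w →H x -> ⊢ w →H (x →H y) -> ⊢ w →H y.
Proof.
intros H1 H2; apply impH_trans with ((x →H y) ∧ x); [now apply and_intro|].
apply uncurry, impH_refl.
Qed.

Lemma impH_imp_congr_l w a b c :
  ⊢ w →H (a →H b) -> ⊢ w →H (b →H a) -> ⊢ w →H (a → c) -> ⊢ w →H (b → c).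
Proof.
intros H1 H2 H3; apply impH_mp with (a → c); trivial.
apply impH_mp with (b →H a); trivial; apply impH_mp with (a →H b); trivial.
apply weaken, D_base, A10.
Qed.

Lemma impH_imp_congr_r w a b c :
  ⊢ w →H (a →H b) -> ⊢ w →H (b →H a) -> ⊢ w →H (c → b) -> ⊢ w →H (c → a).
Proof.
intros H1 H2 H3; apply impH_mp with (c → b); trivial.
apply impH_mp with (b →H a); trivial; apply impH_mp with (a →H b); trivial.
apply weaken, D_base, A11.
Qed.

Lemma impH_top a : ⊢ a →H ⊤.
Proof. apply weaken, D_base, A6. Qed.

Lemma bot_impH a : ⊢ ⊥ →H a.
Proof. apply D_base, A7. Qed.

Lemma top_impH_iff a : ⊢ ⊤ →H a <-> ⊢ a.
Proof.
split; [|apply weaken]; intros H; exact (mp H (D_base _ _ A6)).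
Qed.

Lemma or_l a b : ⊢ a →H (a ∨ b).
Proof. apply D_base, A1. Qed.

Lemma or_r a b : ⊢ b →H (a ∨ b).
Proof. apply D_base, A2. Qed.

Lemma or_elim a b c : ⊢ a →H c -> ⊢ b →H c -> ⊢ (a ∨ b) →H c.
Proof. intros H; apply mp; revert H; apply mp, D_base, A3. Qed.

Lemma top_imp a : (⊢ (⊤ → a) →H a) /\ (⊢ a →H (⊤ → a)).
Proof.
assert (H1 : ⊢ ⊤ ∧ a →H a) by apply and_r.
assert (H2 : ⊢ a →H ⊤ ∧ a) by (apply and_intro; [apply impH_top|apply impH_refl]).
split.
- apply impH_trans with (⊤ →H a); [|apply (impH_mp (x := ⊤)); auto using impH_top, impH_refl].
  apply impH_imp_congr_r with a; auto using weaken, impH_refl.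
- apply impH_trans with (⊤ →H a); [apply weaken_axiom|].
  apply impH_imp_congr_r with (⊤ ∧ a); auto using weaken, impH_refl.
Qed.

(** Under [x], the implication [x → y] is interchangeable with [⊤ → y]. *)
Lemma and_imp x y : (⊢ (x ∧ (x → y)) →H y) /\ (⊢ (x ∧ y) →H (x → y)).
Proof.
split.
- eapply impH_trans; [|apply top_imp].
  apply impH_imp_congr_l with x; auto using and_r, impH_top, weaken.
  apply and_weaken_l, weaken_axiom.
- apply impH_imp_congr_l with ⊤.
  + apply and_weaken_l, weaken_axiom.
  + apply weaken, impH_top.
  + apply and_weaken_r, top_imp.
Qed.

(** Provable equivalence from the premises [G]. *)
Definition equiv a b : Prop := (⊢ a →H b) /\ (⊢ b →H a).

Lemma equiv_refl a : equiv a a.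
Proof. split; apply impH_refl. Qed.

Lemma equiv_sym a b : equiv a b -> equiv b a.
Proof. now intros []. Qed.

Lemma equiv_trans a b c : equiv a b -> equiv b c -> equiv a c.
Proof. intros [] []; split; apply impH_trans with b; trivial. Qed.

(** Equivalence classes of formulas, encoded as the predicates [equiv a], so that
    equality of classes is Leibniz equality. *)
Definition lind_type : Type := {P : formula -> Prop | exists a, P = equiv a}.

Definition cls a : lind_type := exist _ (equiv a) (ex_intro _ a eq_refl).

(** A chosen representative of a class. *)
Definition rep (X : lind_type) : formula := proj1_sig (boolp.cid (proj2_sig X)).

Lemma cls_eq a b : cls a = cls b <-> equiv a b.
Proof.
split.
- intros H; apply (f_equal (@proj1_sig _ _)) in H; cbn in H; rewrite H.
  apply equiv_refl.
- intros H; apply boolp.eq_exist; cbn; apply boolp.predeqP; intros c.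
  split; apply equiv_trans; auto using equiv_sym.
Qed.

Lemma repK X : cls (rep X) = X.
Proof.
unfold rep; destruct X as [P HP], (boolp.cid _) as [a Ha].
apply boolp.eq_exist; symmetry; exact Ha.
Qed.

Lemma equiv_rep a : equiv (rep (cls a)) a.
Proof. apply cls_eq, repK. Qed.

(** The Lindenbaum algebra: formulas modulo [equiv]. *)
Definition lind : algebra :=
  @Algebra lind_type
    (fun X Y => cls (rep X ∨ rep Y))
    (fun X Y => cls (rep X ∧ rep Y))
    (fun X Y => cls (rep X → rep Y))
    (fun X => cls (∼ rep X))
    (cls ⊥) (cls ⊤).

Lemma join_cls a b : join (a := lind) (cls a) (cls b) = cls (a ∨ b).
Proof.
apply cls_eq; destruct (equiv_rep a), (equiv_rep b).
split; apply or_elim; eauto using impH_trans, or_l, or_r.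
Qed.

Lemma meet_cls a b : meet (a := lind) (cls a) (cls b) = cls (a ∧ b).
Proof.
apply cls_eq; destruct (equiv_rep a), (equiv_rep b).
split; apply and_intro; auto using and_weaken_l, and_weaken_r.
Qed.

Lemma imp_cls a b : imp (a := lind) (cls a) (cls b) = cls (a → b).
Proof.
apply cls_eq; destruct (equiv_rep a), (equiv_rep b).
split.
- apply impH_imp_congr_l with (rep (cls a)); auto using weaken.
  apply impH_imp_congr_r with (rep (cls b)); auto using weaken, impH_refl.
- apply impH_imp_congr_l with a; auto using weaken.
  apply impH_imp_congr_r with b; auto using weaken, impH_refl.
Qed.

Lemma prime_cls a : prime (a := lind) (cls a) = cls (∼ a).
Proof. apply cls_eq; destruct (equiv_rep a); split; now apply D_SCP. Qed.

Lemma le_cls a b : le (A := lind) (cls a) (cls b) <-> ⊢ a →H b.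
Proof.
unfold le; rewrite meet_cls, cls_eq; split.
- intros [_ H]; exact (impH_trans H (and_r a b)).
- split; [apply and_l | apply and_intro; auto using impH_refl].
Qed.

Lemma cls_top a : cls a = one (a := lind) <-> ⊢ a.
Proof.
change (@one lind) with (cls ⊤); rewrite cls_eq, <- top_impH_iff.
split; [intros []; trivial | split; trivial; apply impH_top].
Qed.

Lemma eval_cls (s : nat -> formula) a :
  eval (A := lind) (fun n => cls (s n)) a = cls (subst s a).
Proof.
induction a; cbn -[lind]; rewrite ?IHa, ?IHa1, ?IHa2; auto using join_cls,
  meet_cls, imp_cls, prime_cls.
Qed.

(* Turns a statement about all classes into provable equivalences or entailments. *)
Ltac by_cls :=
  repeat match goal with |- forall X : carrier lind, _ =>
    let X := fresh in let a := fresh "a" in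
    intros X; rewrite <- (repK X); generalize (rep X); clear X; intros a end;
  unfold star;
  change (@one lind) with (cls ⊤); change (@zero lind) with (cls ⊥);
  rewrite ?prime_cls, ?join_cls, ?meet_cls, ?imp_cls,
    ?prime_cls, ?join_cls, ?meet_cls, ?imp_cls,
    ?prime_cls, ?join_cls, ?meet_cls, ?imp_cls;
  rewrite ?cls_eq, ?le_cls.

Lemma lind_DHMSH : DHMSH lind.
Proof.
split; [split; [|split; [|split]] | split; [|split]].
- repeat split; by_cls; repeat split; repeat first [apply and_intro|apply or_elim];
    eauto 6 using impH_refl, and_l, and_r, and_ll, and_lr, and_weaken_l, and_weaken_r,
      or_l, or_r, impH_trans, bot_impH, impH_top.
- by_cls; split; apply and_intro; auto using and_l; apply and_imp.
- by_cls; split; apply and_intro; auto using and_l.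
  + apply impH_imp_congr_l with a0; [| |apply impH_imp_congr_r with a1].
    * apply curry, and_intro; [apply and_ll|apply and_r].
    * apply weaken, and_r.
    * apply weaken, and_r.
    * apply curry, and_intro; [apply and_ll|apply and_r].
    * apply and_r.
  + apply impH_imp_congr_l with (a ∧ a0); [| |apply impH_imp_congr_r with (a ∧ a1)].
    * apply weaken, and_r.
    * apply curry, and_intro; [apply and_ll|apply and_r].
    * apply curry, and_intro; [apply and_ll|apply and_r].
    * apply weaken, and_r.
    * apply and_r.
- by_cls; split; [apply impH_top|].
  apply impH_imp_congr_r with (a ∧ a).
  + apply weaken, and_intro; apply impH_refl.
  + apply weaken, and_l.
  + apply weaken, impH_refl.
- by_cls; split; [apply impH_top|apply D_base, A12].
- by_cls; split; [apply D_base, A13|apply bot_impH].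
- by_cls; split; [apply D_base, A14|].
  apply or_elim; apply D_SCP; [apply and_l|apply and_r].
Qed.

Lemma lind_models : models E lind.
Proof.
split; [apply lind_DHMSH|]; intros a Ha v.
replace v with (fun n => cls (rep (v n))) by (apply boolp.funext; intros n; apply repK).
rewrite eval_cls, cls_top; now apply D_scheme.
Qed.

End Lindenbaum.

(** The Lindenbaum algebra over [E] and [G] makes every scheme of [E'] hold, so their
    instances are already derivable from [G] in [E]. *)
Lemma derivable_models E E' G a :
  (forall A, models E A -> models E' A) ->
  derivable E' G a -> derivable E G a.
Proof.
intros HE Ha; induction Ha as [a Ha|a Ha|a s Ha|a b _ IHa _ IHab|a b _ IHab].
- now apply D_premise.
- now apply D_base.
- destruct (HE _ (lind_models E G)) as [_ H].
  specialize (H a Ha (fun n => cls E G (s n))).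
  rewrite eval_cls in H; now apply cls_top in H.
- now apply D_SMP with a.
- now apply D_SCP.
Qed.

(** The uniqueness clause of [is_logic_of] always holds. *)
Lemma is_logic_of_corresponds E V : is_logic_of E V <-> corresponds E V.
Proof.
split; [now intros []|]; intros HE; split; trivial; intros E' HE' G a.
rewrite corresponds_models in HE, HE'.
split; apply derivable_models; intros A; rewrite <- HE, <- HE'; trivial.
Qed.

(** * Prime filters *)

(** Proper filters. *)
Record is_filter (A : algebra) (P : A -> Prop) : Prop := {
  filter_one : P one;
  filter_zero : ~ P zero;
  filter_meet : forall x y, P x -> P y -> P (x ⊓ y);
  filter_up : forall x y, x ≤ y -> P x -> P y
}.

Definition is_prime (A : algebra) (P : A -> Prop) : Prop :=
  is_filter P /\ forall x y, P (x ⊔ y) -> P x \/ P y.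

Lemma pred_ext (T : Type) (P Q : T -> Prop) :
  (forall x, P x -> Q x) -> (forall x, Q x -> P x) -> P = Q.
Proof. intros H1 H2; apply boolp.predeqP; split; auto. Qed.

(** Prime filter theorem: a point outside an ideal [J] belongs to a prime filter disjoint
    from [J]. *)
Lemma prime_filter_separation (A : algebra) (HA : semi_Heyting A)
    (J : A -> Prop) (x : A) :
  (forall y z, y ≤ z -> J z -> J y) ->
  (forall y z, J y -> J z -> J (y ⊔ z)) ->
  J zero -> ~ J x ->
  exists P, is_prime P /\ P x /\ forall y, P y -> ~ J y.
Proof.
intros Jdown Jjoin J0 Jx.
pose (good := fun P : A -> Prop =>
  (forall y z, P y -> P z -> P (y ⊓ z)) /\ (forall y z, y ≤ z -> P y -> P z) /\
  (forall y, P y -> ~ J y) /\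
  (* the union of the empty chain must be good *)
  (forall y, P y -> P x)).
destruct (@classical_sets.Zorn_bigcup A good) as (P & HP & Pmax).
{ intros F HF Ftot; split; [|split; [|split]].
  - intros y z [P FP Py] [Q FQ Qz]; destruct (Ftot P Q FP FQ) as [PQ|QP].
    + exists Q; trivial; apply (HF Q FQ); trivial; now apply PQ.
    + exists P; trivial; apply (HF P FP); trivial; now apply QP.
  - intros y z yz [P FP Py]; exists P; trivial; now apply (proj1 (proj2 (HF P FP)) y).
  - intros y [P FP Py]; now apply (proj1 (proj2 (proj2 (HF P FP)))).
  - intros y [P FP Py]; exists P; trivial; now apply (proj2 (proj2 (proj2 (HF P FP))) y). }
assert (Pmax' : forall Q, good Q -> (forall y, P y -> Q y) -> forall y, Q y -> P y).
{ intros Q HQ PQ y Qy; destruct (boolp.EM (P y)) as [|nPy]; trivial.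
  exfalso; apply (Pmax Q); trivial; split; trivial; intros QP; now apply nPy, QP. }
destruct HP as (Pmeet & Pup & PJ & Px').
assert (Px : P x).
{ destruct (boolp.EM (P x)) as [|nPx]; trivial.
  apply (Pmax' (fun z => x ≤ z)); auto with lat.
  - split; [|split; [|split]]; eauto using le_trans with lat.
  - intros y Py; destruct nPx; eauto. }
exists P; split; [split; [split|]|]; auto with lat.
- apply (Pup x); auto with lat.
- intros P0; exact (PJ _ P0 J0).
- (* if [P] misses [y], the filter generated by [P] and [y] meets [J] *)
  assert (Hext : forall y, ~ P y -> exists p, P p /\ J (p ⊓ y)).
  { intros y nPy.
    pose (Q := fun w => exists p, P p /\ p ⊓ y ≤ w).
    destruct (boolp.EM (exists w, Q w /\ J w)) as [(w & (p & Pp & pw) & Jw)|HQ].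
    { exists p; eauto. }
    destruct nPy; apply (Pmax' Q); [| |exists x; auto with lat].
    - split; [|split; [|split]].
      + intros u v (p & Pp & Hp) (q & Pq & Hq); exists (p ⊓ q); split; auto.
        apply le_meet; trivial.
        * apply le_trans with (p ⊓ y); auto with lat.
        * apply le_trans with (q ⊓ y); auto with lat.
      + intros u v uv (p & Pp & Hp); exists p; split; eauto using le_trans.
      + intros w Qw Jw; apply HQ; eauto.
      + intros _ _; exists x; auto with lat.
    - intros w Pw; exists w; auto with lat. }
  intros y z Pyz.
  destruct (boolp.EM (P y)) as [|nPy]; auto; destruct (boolp.EM (P z)) as [|nPz]; auto.
  destruct (Hext y nPy) as (p & Pp & Jp), (Hext z nPz) as (q & Pq & Jq).
  destruct (PJ ((p ⊓ q) ⊓ (y ⊔ z))); auto.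
  apply (Jdown _ ((p ⊓ y) ⊔ (q ⊓ z))); auto; apply meet_join_le; trivial.
  + apply le_trans with (p ⊓ y); auto 6 with lat.
  + apply le_trans with (q ⊓ z); auto 6 with lat.
Qed.

Section PrimeFilters.
Context (A : algebra) (HV : RDQDStSH1 A).
Implicit Types (x y z : A) (P Q : A -> Prop).

Let HA : DHMSH A. Proof. apply HV. Qed.
Let HS : semi_Heyting A. Proof. apply HA. Qed.

Lemma prime_meet x y : prime (x ⊓ y) = prime x ⊔ prime y.
Proof. apply HV. Qed.

Lemma prime_one : prime one = zero :> A. Proof. apply HV. Qed.
Lemma prime_zero : prime zero = one :> A. Proof. apply HV. Qed.

Lemma prime2_join x y :
  prime (prime (x ⊔ y)) = prime (prime x) ⊔ prime (prime y).
Proof. apply HV. Qed.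

Lemma prime3 x : prime (prime (prime x)) = prime x. Proof. apply HV. Qed.
Lemma prime2_le x : prime (prime x) ≤ x. Proof. apply HV. Qed.

Lemma prime_join x y : prime (x ⊔ y) = prime (prime (prime x ⊓ prime y)).
Proof. now rewrite prime_meet, <- prime2_join, prime3. Qed.

(** For a prime filter [P], [maxf P] is the unique maximal filter containing it. *)
Definition maxf P : A -> Prop := fun x => ~ P (star x).

(** The action of [prime] on filters, which reverses inclusions. *)
Definition polar P : A -> Prop := fun x => ~ P (prime x).

(** For prime filters this is maximality under inclusion. *)
Definition maximal P : Prop := maxf P = P.

Lemma not_not (X : Prop) : ~ ~ X -> X.
Proof. apply boolp.contrapT. Qed.

Lemma filter_disjoint P x y : is_filter P -> x ⊓ y = zero -> P x -> ~ P y.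
Proof.
intros HP H Px Py; apply (filter_zero HP); rewrite <- H; now apply filter_meet.
Qed.

Lemma maxf_sup P : is_filter P -> forall x, P x -> maxf P x.
Proof. intros HP x Px; apply (filter_disjoint HP (meet_star HS x) Px). Qed.

Lemma maxfP P x : is_prime P -> maxf P x <-> P (star (star x)).
Proof.
intros [HP Pjoin]; split.
- intros Mx; destruct (Pjoin (star x) (star (star x))); [|contradiction|trivial].
  replace (star x ⊔ star (star x)) with (@one A); [apply (filter_one HP)|].
  symmetry; apply HV.
- intros Pxx Px; revert Pxx; apply (filter_disjoint HP (meet_star HS _) Px).
Qed.

Lemma maxf_prime P : is_prime P -> is_prime (maxf P).
Proof.
intros HP; pose proof (proj1 HP) as FP; split; [split|].
- unfold maxf; rewrite (star_one HS); apply (filter_zero FP).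
- intros H; apply H; rewrite (star_zero HS); apply (filter_one FP).
- intros x y Mx My H; apply (maxfP _ HP) in Mx as Px; apply (maxfP _ HP) in My as Py.
  apply (filter_zero FP).
  refine (filter_up FP _ (filter_meet FP (filter_meet FP H Px) Py)).
  (* [s ⊓ x** ≤ y*], where [s := (x ⊓ y)*] *)
  set (s := star (x ⊓ y)).
  assert (Hs : x ⊓ (s ⊓ y) = zero).
  { apply le_zero; trivial; rewrite <- (meet_star HS (x ⊓ y)); unfold s.
    auto 6 with lat. }
  apply (le_star HS) in Hs.
  assert (Ht : y ⊓ (s ⊓ star (star x)) = zero).
  { apply le_zero; trivial; rewrite <- (meet_star HS (star x)).
    apply le_meet; auto with lat; apply le_trans with (s ⊓ y); auto with lat. }
  apply (le_star HS) in Ht; rewrite <- (meet_star HS (star y)).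
  auto with lat.
- intros x y xy Mx Py; apply Mx; revert Py; apply (filter_up FP), star_le; auto.
- intros x y Mxy; destruct (boolp.EM (maxf P x)) as [|Mx]; auto.
  right; intros Py; apply not_not in Mx; apply Mxy.
  refine (filter_up FP _ (filter_meet FP Mx Py)).
  apply le_star; trivial; rewrite meetC; trivial.
  apply le_zero; trivial; apply meet_join_le; trivial.
  + rewrite <- (meet_star HS x); auto 6 with lat.
  + rewrite <- (meet_star HS y); auto 6 with lat.
Qed.

Lemma maxf_sub P Q : is_prime P -> is_prime Q ->
  (forall x, Q x -> P x) -> maxf Q = maxf P.
Proof.
intros HP HQ QP; apply pred_ext; intros x.
- rewrite !maxfP; auto.
- intros H1 H2; apply H1; auto.
Qed.

Lemma maxf_maximal P : is_prime P -> maximal (maxf P).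
Proof.
intros HP; symmetry; apply maxf_sub; auto using maxf_prime.
apply maxf_sup, HP.
Qed.

Lemma not_maximal P : is_prime P -> ~ maximal P -> exists y, maxf P y /\ ~ P y.
Proof.
intros HP nM; apply not_not; intros H; apply nM, pred_ext.
- intros x Mx; apply not_not; intros Px; apply H; eauto.
- apply maxf_sup, HP.
Qed.

Lemma polar_filter P : is_prime P -> is_filter (polar P).
Proof.
intros [HP Pjoin]; split; unfold polar.
- rewrite prime_one; apply (filter_zero HP).
- rewrite prime_zero; intros H; apply H, (filter_one HP).
- intros x y; rewrite prime_meet; intros Px Py H; now destruct (Pjoin _ _ H).
- intros x y xy Px Py; apply Px; revert Py; apply (filter_up HP), prime_le; auto.
Qed.

Lemma polar_anti P Q : (forall x, P x -> Q x) -> forall x, polar Q x -> polar P x.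
Proof. unfold polar; auto. Qed.

Lemma polar2_sub P : is_filter P -> forall x, polar (polar P) x -> P x.
Proof.
intros HP x Px; apply not_not in Px; revert Px; apply (filter_up HP), prime2_le.
Qed.

(** For prime [P], [polar P] is a filter, but primeness is derived when [P] is a fixed point of
    the double polar, since [prime (x ⊔ y)] is only the double [prime] of
    [prime x ⊓ prime y]. *)
Lemma polar_prime P : is_prime P -> polar (polar P) = P -> is_prime (polar P).
Proof.
intros HP HPP; split; [now apply polar_filter|]; intros x y Hxy.
destruct (boolp.EM (polar P x)) as [|nx]; auto.
destruct (boolp.EM (polar P y)) as [|ny]; auto.
apply not_not in nx, ny; exfalso; revert Hxy; unfold polar; rewrite prime_join.
intros H; apply H, not_not; change (polar (polar P) (prime x ⊓ prime y)).
rewrite HPP; now apply (filter_meet (proj1 HP)).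
Qed.

(** Regularity at a prime filter that is not maximal. *)
Lemma regular_nonmaximal P x : is_prime P -> ~ maximal P ->
  P x -> polar P (star (prime x)).
Proof.
intros HP nM Px H.
destruct (not_maximal HP nM) as (y & My & nPy).
destruct HP as [FP Pjoin]; destruct (Pjoin y (star y)); [|contradiction|contradiction].
destruct HV as (_ & HR & _).
refine (filter_up FP (HR x y) (filter_meet FP Px H)).
Qed.

Lemma polar2_nonmaximal P : is_prime P -> ~ maximal P -> polar (polar P) = P.
Proof.
intros HP nM; apply pred_ext; [apply polar2_sub, HP|].
intros x Px H; pose proof (regular_nonmaximal HP nM Px) as H'.
exact (filter_disjoint (polar_filter HP) (meet_star HS _) H H').
Qed.

Lemma polar_maxf_polar P : is_prime P -> ~ maximal P ->
  polar (maxf (polar P)) = P.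
Proof.
intros HP nM; pose proof (polar2_nonmaximal HP nM) as HPP; apply pred_ext.
- intros x Hx; rewrite <- HPP; revert Hx; apply polar_anti, maxf_sup.
  now apply polar_filter.
- intros x Px H; apply H; now apply regular_nonmaximal.
Qed.

(** Level 1 at a maximal filter [M]. *)
Lemma level1_maximal M x : is_prime M -> maximal M ->
  M x -> polar M x -> polar M (star (prime x)).
Proof.
intros HM MM Mx Hx H; destruct HM as [FM _].
assert (Hx' : M (star (prime x))).
{ apply not_not; intros H'; apply Hx; rewrite <- MM; exact H'. }
destruct HV as (_ & _ & _ & HL); specialize (HL x).
apply (filter_disjoint FM (meet_star HS _) H).
refine (filter_up FM _ (filter_meet FM Mx Hx')); rewrite HL; auto with lat.
Qed.

(** In the chain of the two prime filters [P] and [maxf P], [prime] acts as in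
    [L1dp] and [L3dp] (first case), or as in [L1dm] and [L3dm] (second case). *)
Lemma polar_nonmaximal P : is_prime P -> ~ maximal P ->
  polar (maxf P) = P /\ (polar P = P \/ polar P = maxf P).
Proof.
intros HP nM.
pose proof (polar2_nonmaximal HP nM) as HPP.
pose proof (polar_maxf_polar HP nM) as HPMP.
pose proof (polar_prime HP HPP) as HQ.
pose proof (maxf_prime HP) as HM; pose proof (maxf_maximal HP) as MM.
assert (PM : forall x, P x -> maxf P x) by apply maxf_sup, HP.
destruct (not_maximal HP nM) as (m & Mm & nPm).
(* [polar (maxf P)] is included in [P], since the joins of its elements with [m]
   are in [P] by level 1 *)
assert (HMP : forall x, polar (maxf P) x -> P x).
{ intros n Hn; destruct (proj2 HP m n) as [|]; [|contradiction|trivial].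
  assert (Mmn : maxf P (m ⊔ n)) by (apply (filter_up (proj1 HM) (x := m)); auto with lat).
  assert (Hmn : polar (maxf P) (m ⊔ n)).
  { apply (filter_up (polar_filter HM) (x := n)); auto with lat. }
  pose proof (polar_anti PM (level1_maximal HM MM Mmn Hmn)) as H.
  rewrite <- HPMP; intros H'; exact (H' H). }
assert (HQM : maxf (polar P) = maxf P).
{ rewrite <- MM; apply maxf_sub; trivial; intros x Hx.
  apply polar2_sub; [apply HM|]; now apply (polar_anti HMP). }
assert (HM' : polar (maxf P) = P) by now rewrite <- HQM.
split; trivial; destruct (boolp.EM (maximal (polar P))) as [mQ|nQ].
- right; now rewrite <- HQM.
- left; pose proof (polar_maxf_polar HQ nQ) as H; rewrite HPP in H; congruence.
Qed.

(** A maximal filter that is not a fixed point of the double polar lies above a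
    prime filter that is not maximal. *)
Lemma prime_below_maximal P : is_prime P -> maximal P -> polar (polar P) <> P ->
  exists Q, is_prime Q /\ ~ maximal Q /\ maxf Q = P.
Proof.
intros HP MP nP.
assert (exists u, P u /\ ~ P (prime (prime u))) as (u & Pu & Pu'').
{ apply not_not; intros H; apply nP, pred_ext; [apply polar2_sub, HP|].
  intros x Px Px''; apply H; exists x; auto. }
(* the ideal generated by [u] and the complement of [P] is proper *)
destruct (@prime_filter_separation A HS
  (fun w => exists z, ~ P z /\ w ≤ u ⊔ z) one) as (Q & HQ & _ & QJ).
- intros y z yz (w & nPw & Hw); exists w; eauto using le_trans.
- intros y z (v & nPv & Hv) (w & nPw & Hw); exists (v ⊔ w); split.
  + intros H; destruct (proj2 HP _ _ H); auto.
  + apply (join_le HS); [apply (le_trans HS Hv) | apply (le_trans HS Hw)];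
      apply (join_le HS); auto with lat.
- exists zero; split; [apply (filter_zero (proj1 HP)) | auto with lat].
- intros (z & nPz & Hz); apply (proj1 (one_le HS _)) in Hz.
  assert (H : P (prime (prime u) ⊔ prime (prime z))).
  { rewrite <- prime2_join, Hz, prime_one, prime_zero; apply (filter_one (proj1 HP)). }
  destruct (proj2 HP _ _ H) as [|H']; [contradiction|].
  apply nPz; revert H'; apply (filter_up (proj1 HP)), prime2_le.
- assert (QP : forall x, Q x -> P x).
  { intros x Qx; apply not_not; intros nPx; apply (QJ x Qx); exists x; auto with lat. }
  assert (HQP : maxf Q = P) by (rewrite <- MP; now apply maxf_sub).
  exists Q; split; [|split]; trivial; intros MQ.
  apply (QJ u); [congruence|]; exists zero.
  split; [apply (filter_zero (proj1 HP)) | auto with lat].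
Qed.

End PrimeFilters.

(** * Homomorphisms onto the generating algebras *)

(** An index type for the five generators, in a universe low enough to index a product. *)
Inductive generator_index : Set := iL1dm | iL1dp | iL3dm | iL3dp | iD2.

Definition generator (i : generator_index) : algebra :=
  match i with
  | iL1dm => L1dm | iL1dp => L1dp | iL3dm => L3dm | iL3dp => L3dp | iD2 => D2
  end.

Section Representation.
Context (A : algebra) (HV : RDQDStSH1 A) (H01 : forall y : A, (zero ⇒ y) = one).
Implicit Types (x y z : A) (P Q : A -> Prop).

Let HA : DHMSH A. Proof. apply HV. Qed.
Let HS : semi_Heyting A. Proof. apply HA. Qed.

(** Membership in [P] factors through a homomorphism to one of the generators. *)
Definition represented P : Prop :=
  exists (i : generator_index) (f : A -> generator i),
    is_hom f /\ forall x y, f x = f y -> P x -> P y.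

Lemma is_prime_join P x y : is_prime P -> P (x ⊔ y) <-> P x \/ P y.
Proof.
intros [HP Pjoin]; split; [apply Pjoin|].
intros [H|H]; revert H; apply (filter_up HP); auto with lat.
Qed.

Lemma is_filter_meet P x y : is_filter P -> P (x ⊓ y) <-> P x /\ P y.
Proof.
intros HP; split; [|now intros []; apply (filter_meet HP)].
intros H; split; revert H; apply (filter_up HP); auto with lat.
Qed.

Lemma is_filter_imp P x y : is_filter P -> P x -> P (x ⇒ y) <-> P y.
Proof.
intros HP Px.
assert (H := meet_imp HS x y).
split; intros Py.
- apply (is_filter_meet x y HP); rewrite <- H; now apply (filter_meet HP).
- apply (is_filter_meet x (x ⇒ y) HP); rewrite H; now apply (filter_meet HP).
Qed.

(** The only use of [0 ⇒ y = 1]: it gives [x* ≤ (x ⇒ y)]. *)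
Lemma not_maxf_imp P x y : is_filter P -> ~ maxf P x -> P (x ⇒ y).
Proof.
intros HP nMx; apply not_not in nMx; revert nMx; apply (filter_up HP).
unfold le; rewrite (meet_imp_rel HS), (meetC HS _ x), (meet_star HS), H01.
apply (le_one HS).
Qed.

Lemma D2_represented P : is_prime P -> maximal P -> maximal (polar P) ->
  polar (polar P) = P -> represented P.
Proof.
intros HP MP MQ HPP.
pose proof (polar_prime HV HP HPP) as HQ.
exists iD2, (fun x => (boolp.asbool (P x), boolp.asbool (polar P x))).
assert (Himp : forall Q x y, is_prime Q -> maximal Q -> Q (x ⇒ y) <-> (Q x -> Q y)).
{ intros Q x y [FQ _] HM; split.
  - intros H Qx; now apply (is_filter_imp y FQ Qx).
  - intros H; destruct (boolp.EM (Q x)) as [Qx|nQx]; [apply (is_filter_imp y FQ); auto|].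
    apply (not_maxf_imp (x := x) y FQ); now rewrite HM. }
assert (Hor : forall X Y : Prop, boolp.asbool (X \/ Y) = orb (boolp.asbool X) (boolp.asbool Y))
  by (intros; apply boolp.asbool_or).
assert (Hand : forall X Y : Prop, boolp.asbool (X /\ Y) = andb (boolp.asbool X) (boolp.asbool Y))
  by (intros; apply boolp.asbool_and).
assert (Hneg : forall X : Prop, boolp.asbool (~ X) = negb (boolp.asbool X))
  by (intros; apply boolp.asbool_neg).
assert (Himpl : forall X Y : Prop,
  boolp.asbool (X -> Y) = orb (negb (boolp.asbool X)) (boolp.asbool Y)).
{ intros X Y; rewrite <- Hneg, <- Hor; apply boolp.asbool_equiv_eq.
  split; [|tauto]; intros H; destruct (boolp.EM X); auto. }
assert (Hext : forall X Y : Prop, X <-> Y -> boolp.asbool X = boolp.asbool Y)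
  by (intros; now apply boolp.asbool_equiv_eq).
split; [repeat split; cbn|].
- intros x y; rewrite <- !Hor; f_equal; now apply Hext, is_prime_join.
- intros x y; rewrite <- !Hand; f_equal; apply Hext, is_filter_meet; [apply HP|apply HQ].
- intros x y; rewrite <- !Himpl; f_equal; now apply Hext, Himp.
- intros x.
  replace (boolp.asbool (P (prime x))) with (negb (boolp.asbool (polar P x))).
  replace (boolp.asbool (polar P (prime x))) with (negb (boolp.asbool (P x))).
  + now destruct (boolp.asbool (P x)), (boolp.asbool (polar P x)).
  + rewrite <- Hneg; apply Hext.
    assert (E : P x <-> ~ polar P (prime x)) by (now rewrite <- (f_equal (fun Q => Q x) HPP)).
    rewrite E; split; [apply not_not|tauto].
  + unfold polar; rewrite Hneg; now destruct (boolp.asbool _).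
- f_equal; apply boolp.asboolF; [apply HP|apply HQ].
- f_equal; apply boolp.asboolT; [apply HP|apply HQ].
- intros x y H Px; injection H; intros _ H'.
  apply (boolp.asboolW (P := P y)); rewrite <- H'; now apply boolp.asboolT.
Qed.

Section Chain.
Context (P : A -> Prop) (HP : is_prime P) (nM : ~ maximal P).
Let M := maxf P.

(** An element of [maxf P] outside [P] is below all others modulo the filter [P].  The witness
    comes from regularity, [x ⊓ x'*' ≤ y ⊔ y*], by meeting with [y**]. *)
Lemma middle_le x y : M x -> ~ P x -> M y -> exists p, P p /\ p ⊓ x ≤ y.
Proof.
intros Mx nPx My; exists (prime (star (prime x)) ⊓ star (star y)).
destruct (polar_nonmaximal HV HP nM) as [HMP HPM].
pose proof (maxf_prime HV HP) as HM.
assert (PM : forall x, P x -> M x) by (apply maxf_sup; trivial; apply HP).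
split.
- apply (filter_meet (proj1 HP)); [|now apply maxfP].
  apply not_not; intros H.
  assert (Mxs : M (star (prime x))).
  { change (polar P (star (prime x))) in H.
    destruct HPM as [HPM|HPM]; rewrite HPM in H; auto. }
  assert (Mx' : M (prime x)).
  { rewrite <- HMP in nPx; now apply not_not in nPx. }
  exact (filter_disjoint (proj1 HM) (meet_star HS _) Mx' Mxs).
- destruct HV as (_ & HR & _); specialize (HR x y).
  apply (le_trans HS) with (star (star y) ⊓ (y ⊔ star y)).
  + apply (le_meet HS); auto with lat.
    refine (le_trans HS _ HR); unfold plus; auto with lat.
  + apply (meet_join_le HS); auto with lat.
    rewrite (meetC HS), (meet_star HS); auto with lat.
Qed.

Lemma middle_eq x y : M x -> ~ P x -> M y -> ~ P y ->
  exists p, P p /\ p ⊓ x = p ⊓ y.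
Proof.
intros Mx nPx My nPy.
destruct (middle_le Mx nPx My) as (p & Pp & Hp).
destruct (middle_le My nPy Mx) as (q & Pq & Hq).
exists (p ⊓ q); split; [now apply (filter_meet (proj1 HP))|].
apply (le_antisym HS); apply (le_meet HS); auto with lat.
- refine (le_trans HS _ Hp); auto with lat.
- refine (le_trans HS _ Hq); auto with lat.
Qed.

Lemma middle_imp x y : M x -> ~ P x -> M y -> ~ P y -> P (x ⇒ y).
Proof.
intros Mx nPx My nPy.
destruct (middle_eq Mx nPx My nPy) as (p & Pp & Hp).
apply (is_filter_meet p (x ⇒ y) (proj1 HP)).
now rewrite (meet_imp_rel HS), Hp, (impxx HS), (le_one HS).
Qed.

(** Whether [a ⇒ 1] is 1 or [a] does not depend on the representatives. *)
Lemma middle_imp_top x y x' y' : M x -> ~ P x -> P y -> M x' -> ~ P x' -> P y' ->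
  P (x ⇒ y) -> P (x' ⇒ y').
Proof.
intros Mx nPx Py Mx' nPx' Py' H.
destruct (middle_eq Mx nPx Mx' nPx') as (p & Pp & Hp).
set (q := p ⊓ (y ⊓ y')).
assert (Hx : q ⊓ x = q ⊓ x').
{ unfold q; rewrite (meetC HS p), <- !(meetA HS); now rewrite Hp. }
assert (Hy : q ⊓ y = q ⊓ y').
{ unfold q; apply (le_antisym HS); auto 6 with lat. }
apply (is_filter_meet q (x' ⇒ y') (proj1 HP)).
rewrite <- (meet_imp_congr HS Hx Hy).
repeat apply (filter_meet (proj1 HP)); trivial.
Qed.

(** The map to the three-element chain with cut points [P] and [maxf P]. *)
Definition chain_map x : chain3 :=
  if boolp.pselect (P x) then c1 else if boolp.pselect (M x) then ca else c0.

Lemma chain_map_1 x : P x -> chain_map x = c1.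
Proof. unfold chain_map; now destruct (boolp.pselect (P x)). Qed.

Lemma chain_map_a x : ~ P x -> M x -> chain_map x = ca.
Proof. unfold chain_map; now destruct (boolp.pselect (P x)), (boolp.pselect (M x)). Qed.

Lemma chain_map_0 x : ~ M x -> chain_map x = c0.
Proof.
intros nMx; unfold chain_map; destruct (boolp.pselect (P x)) as [Px|_].
- destruct nMx; revert Px; apply maxf_sup; trivial; apply HP.
- now destruct (boolp.pselect (M x)).
Qed.

Lemma chain_mapP x :
  P x /\ M x /\ chain_map x = c1 \/
  ~ P x /\ M x /\ chain_map x = ca \/
  ~ P x /\ ~ M x /\ chain_map x = c0.
Proof.
assert (PM : P x -> M x) by (apply maxf_sup; trivial; apply HP).
destruct (boolp.EM (P x)) as [Px|nPx]; [left; auto using chain_map_1|right].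
destruct (boolp.EM (M x)); [left|right]; auto using chain_map_a, chain_map_0.
Qed.

Lemma chain_map_hom (imp3 : chain3 -> chain3 -> chain3) (prime3 : chain3 -> chain3) :
  (imp3 = imp_L1 /\ (forall x y, M x -> ~ P x -> P y -> P (x ⇒ y))) \/
  (imp3 = imp_L3 /\ (forall x y, M x -> ~ P x -> P y -> ~ P (x ⇒ y))) ->
  (prime3 = prime_dm /\ polar P = M) \/ (prime3 = prime_dp /\ polar P = P) ->
  is_hom (B := Algebra join3 meet3 imp3 prime3 c0 c1) chain_map.
Proof.
intros Himp Hprime.
pose proof (maxf_prime HV HP) as HM; fold M in HM.
pose proof (proj1 (polar_nonmaximal HV HP nM)) as HMP; fold M in HMP.
repeat split; cbn.
- intros x y.
  pose proof (is_prime_join x y HP); pose proof (is_prime_join x y HM).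
  destruct (chain_mapP x) as [(?&?&->)|[(?&?&->)|(?&?&->)]],
    (chain_mapP y) as [(?&?&->)|[(?&?&->)|(?&?&->)]]; cbn;
  (apply chain_map_1 || apply chain_map_a || apply chain_map_0); tauto.
- intros x y.
  pose proof (is_filter_meet x y (proj1 HP)); pose proof (is_filter_meet x y (proj1 HM)).
  destruct (chain_mapP x) as [(?&?&->)|[(?&?&->)|(?&?&->)]],
    (chain_mapP y) as [(?&?&->)|[(?&?&->)|(?&?&->)]]; cbn;
  solve [apply chain_map_1; tauto | apply chain_map_a; tauto | apply chain_map_0; tauto].
- intros x y.
  pose proof (is_filter_imp y (proj1 HP) (x := x)).
  pose proof (is_filter_imp y (proj1 HM) (x := x)).
  assert (~ M x -> P (x ⇒ y)) by exact (not_maxf_imp y (proj1 HP) (x := x)).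
  pose proof (@middle_imp x y).
  destruct Himp as [[-> Htop]|[-> Htop]]; specialize (Htop x y);
  destruct (chain_mapP x) as [(?&?&->)|[(?&?&->)|(?&?&->)]],
    (chain_mapP y) as [(?&?&->)|[(?&?&->)|(?&?&->)]]; cbn;
  solve [apply chain_map_1; tauto | apply chain_map_a; tauto | apply chain_map_0; tauto].
- intros x.
  assert (HMx : P x <-> ~ M (prime x)) by (now rewrite <- (f_equal (fun Q => Q x) HMP)).
  assert (HPx : polar P x <-> ~ P (prime x)) by reflexivity.
  assert (PM : P (prime x) -> M (prime x)) by (apply maxf_sup; trivial; apply HP).
  destruct (boolp.EM (P (prime x))), (boolp.EM (M (prime x)));
  destruct Hprime as [[-> Hpol]|[-> Hpol]]; rewrite Hpol in HPx;
  destruct (chain_mapP x) as [(?&?&->)|[(?&?&->)|(?&?&->)]]; cbn;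
  solve [tauto | apply chain_map_1; tauto | apply chain_map_a; tauto | apply chain_map_0; tauto].
- apply chain_map_0, HM.
- apply chain_map_1, HP.
Qed.

Lemma chain_represented : represented P /\ represented M.
Proof.
enough (exists i (f : A -> generator i), is_hom f /\
  forall x y, f x = f y -> (P x -> P y) /\ (M x -> M y)) as (i & f & Hf & H).
{ split; exists i, f; split; trivial; apply H. }
assert (Hmap : forall x y, chain_map x = chain_map y -> (P x -> P y) /\ (M x -> M y)).
{ intros x y.
  destruct (chain_mapP x) as [(?&?&->)|[(?&?&->)|(?&?&->)]],
    (chain_mapP y) as [(?&?&->)|[(?&?&->)|(?&?&->)]]; easy. }
destruct (polar_nonmaximal HV HP nM) as [_ Hpol].
destruct (boolp.EM (exists x y, M x /\ ~ P x /\ P y /\ P (x ⇒ y)))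
  as [(x0 & y0 & ? & ? & ? & ?)|Himp]; destruct Hpol as [Hpol|Hpol];
[exists iL1dp|exists iL1dm|exists iL3dp|exists iL3dm];
exists chain_map; split; trivial; apply chain_map_hom; auto.
- left; eauto using middle_imp_top.
- left; eauto using middle_imp_top.
- right; split; trivial; intros x y ? ? ? ?; apply Himp; eauto 7.
- right; split; trivial; intros x y ? ? ? ?; apply Himp; eauto 7.
Qed.

End Chain.

Lemma prime_represented P : is_prime P -> represented P.
Proof.
intros HP; destruct (boolp.EM (maximal P)) as [MP|nM];
  [|now apply chain_represented].
destruct (boolp.EM (polar (polar P) = P)) as [HPP|nPP].
- destruct (boolp.EM (maximal (polar P))) as [MQ|nQ]; [now apply D2_represented|].
  pose proof (polar_prime HV HP HPP) as HQ.
  destruct (chain_represented HQ nQ) as [_ H].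
  destruct (polar_nonmaximal HV HQ nQ) as [_ [HQQ|HQQ]]; rewrite HPP in HQQ.
  + destruct nQ; now rewrite <- HQQ.
  + now rewrite HQQ.
- destruct (prime_below_maximal HV HP MP nPP) as (Q & HQ & nQ & <-).
  now apply chain_represented.
Qed.

Lemma homs_separate x y : x <> y ->
  exists i (f : A -> generator i), is_hom f /\ f x <> f y.
Proof.
assert (Hle : forall x y, ~ x ≤ y ->
  exists i (f : A -> generator i), is_hom f /\ f x <> f y).
{ clear x y; intros x y nxy.
  destruct (prime_filter_separation HS (J := fun z => z ≤ y) (x := x))
    as (P & HP & Px & Py); trivial.
  - intros u v uv vy; exact (le_trans HS uv vy).
  - intros u v; apply (join_le HS).
  - apply (zero_le HS).
  - destruct (prime_represented HP) as (i & f & Hf & HfP).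
    exists i, f; split; trivial; intros Hxy.
    apply (Py y); [exact (HfP x y Hxy Px) | apply (le_refl HS)]. }
intros nxy; destruct (boolp.EM (x ≤ y)) as [xy|]; [|auto].
destruct (Hle y x) as (i & f & Hf & Hyx).
- intros yx; apply nxy; now apply (le_antisym HS).
- exists i, f; split; auto.
Qed.

Lemma RDQDStSH1_generated : generated_variety five_algebras A.
Proof.
intros V (_ & VS & VP) HK.
apply (VS (@product {i : generator_index & {f : A -> generator i | is_hom f}}
             (fun k => generator (projT1 k)))
          A (fun x k => proj1_sig (projT2 k) x)).
- repeat split; intros; apply boolp.functional_extensionality_dep;
    intros [i [f Hf]]; cbn; apply Hf.
- intros x y Hxy; apply not_not; intros nxy.
  destruct (homs_separate nxy) as (i & f & Hf & nf); apply nf.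
  exact (f_equal (fun h => h (existT _ i (exist _ f Hf))) Hxy).
- apply VP; intros [[] ?]; apply HK; unfold five_algebras; cbn; tauto.
Qed.

End Representation.

(** * Equational classes *)

(** A pair of terms; formulas serve as terms of the signature. *)
Definition identity : Type := (formula * formula)%type.

(** The algebras satisfying all identities of [L]. *)
Definition equational_class (L : list identity) : class :=
  fun A => forall (v : nat -> A) e, In e L -> eval v (fst e) = eval v (snd e).

Lemma eval_hom (A B : algebra) (f : A -> B) (v : nat -> A) a :
  is_hom f -> f (eval v a) = eval (fun n => f (v n)) a.
Proof.
intros (Hj & Hm & Hi & Hp & H0 & H1).
induction a; cbn; rewrite ?Hj, ?Hm, ?Hi, ?Hp; congruence.
Qed.

Lemma equational_class_variety L : is_variety (equational_class L).
Proof.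
split; [|split].
- intros A B f Hf fsurj HA v e He.
  assert (exists w, forall n, f (w n) = v n) as [w Hw].
  { exists (fun n => proj1_sig (boolp.cid (fsurj (v n)))); intros n.
    now destruct (boolp.cid _). }
  replace v with (fun n => f (w n)) by now apply boolp.funext.
  rewrite <- !eval_hom by trivial; f_equal; now apply HA.
- intros A B f Hf finj HA v e He; apply finj.
  rewrite !eval_hom by trivial; now apply HA.
- intros I A HA v e He; apply boolp.functional_extensionality_dep; intros i.
  assert (Hi : is_hom (A := product A) (fun x => x i)) by (repeat split).
  rewrite !(fun a => eval_hom v a Hi); now apply HA.
Qed.

(** The schemes that express the identities of [L]. *)
Definition identity_schemes (L : list identity) : schemes :=
  fun a => exists e, In e L /\ a = IffH (fst e) (snd e).

Lemma models_identity_schemes L A :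
  models (identity_schemes L) A <-> DHMSH A /\ equational_class L A.
Proof.
split; intros [HA HL]; split; trivial; pose proof (DHMSH_semi_Heyting HA) as HS.
- intros v e He; apply (iffH_one HS).
  apply (HL (IffH (fst e) (snd e))); exists e; auto.
- intros a (e & He & ->) v; apply (iffH_one HS); now apply HL.
Qed.

Section Identities.
Local Open Scope formula_scope.

(** The defining identities of [RDQDStSH1], inequalities being written with the meet:
    bounded lattices, semi-Heyting algebras, [DHMSH], [DQDSH], regularity, Stone,
    level 1. *)
Definition RDQDStSH1_identities : list identity :=
  let x := Var 0 in let y := Var 1 in let z := Var 2 in
  (x ∨ y, y ∨ x) ::
  (x ∧ y, y ∧ x) ::
  (x ∨ (y ∨ z), (x ∨ y) ∨ z) ::
  (x ∧ (y ∧ z), (x ∧ y) ∧ z) ::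
  (x ∨ (x ∧ y), x) ::
  (x ∧ (x ∨ y), x) ::
  (⊥ ∧ x, ⊥) ::
  (x ∧ ⊤, x) ::
  (x ∧ (x → y), x ∧ y) ::
  (x ∧ (y → z), x ∧ ((x ∧ y) → (x ∧ z))) ::
  (x → x, ⊤) ::
  (∼ ⊥, ⊤) ::
  (∼ ⊤, ⊥) ::
  (∼ (x ∧ y), ∼ x ∨ ∼ y) ::
  (∼ ∼ (x ∨ y), ∼ ∼ x ∨ ∼ ∼ y) ::
  (∼ ∼ ∼ x, ∼ x) ::
  (∼ ∼ x ∧ x, ∼ ∼ x) ::
  ((x ∧ ∼ (∼ x → ⊥)) ∧ (y ∨ (y → ⊥)), x ∧ ∼ (∼ x → ⊥)) ::
  ((x → ⊥) ∨ ((x → ⊥) → ⊥), ⊤) ::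
  (x ∧ (∼ x → ⊥), (x ∧ (∼ x → ⊥)) ∧ (∼ (∼ x → ⊥) → ⊥)) ::
  nil.

Definition bot_imp_identity : identity := (⊥ → Var 0, ⊤).

End Identities.

Lemma RDQDStSH1_equational A :
  RDQDStSH1 A <-> equational_class RDQDStSH1_identities A.
Proof.
split.
- intros H v e He; cbn in He.
  repeat match type of He with _ \/ _ => destruct He as [<-|He] end;
    [cbn; apply H..|destruct He].
- intros H.
  assert (Hv : forall v : nat -> A, fold_right
    (fun e X => eval v (fst e) = eval v (snd e) /\ X) True RDQDStSH1_identities).
  { intros v; specialize (H v); induction RDQDStSH1_identities; cbn; auto.
    split; [apply H; now left|apply IHl; intros e He; apply H; now right]. }
  (* identities in fewer than three variables are instantiated with repetitions *)
  assert (Hxyz : forall x y z : A, _) by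
    exact (fun x y z => Hv (fun n => match n with 0 => x | 1 => y | _ => z end)).
  clear H Hv; cbn in Hxyz.
  repeat split; (intros x y z; apply (Hxyz x y z)) || (intros x y; apply (Hxyz x y x))
    || (intros x; apply (Hxyz x x x)) || apply (Hxyz one one one).
Qed.

Lemma five_algebras_RDQDStSH1 A : five_algebras A ->
  RDQDStSH1 A /\ forall y : A, imp zero y = one.
Proof.
intros [-> | [-> | [-> | [-> | ->]]]]; repeat split; cbn;
  repeat (intros [[|] [|]] || intros [| |]); reflexivity.
Qed.

(** Within [RDQDStSH1] the five algebras generate the subvariety of [0 ⇒ y = 1]. *)
Lemma generated_variety_five A :
  generated_variety five_algebras A <->
  RDQDStSH1 A /\ forall y : A, imp zero y = one.
Proof.
assert (H : forall B, equational_class (bot_imp_identity :: RDQDStSH1_identities) B <->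
  RDQDStSH1 B /\ forall y : B, imp zero y = one).
{ intros B; rewrite RDQDStSH1_equational; split.
  - intros HB; split; [intros v e He; apply HB; now right|].
    intros y; apply (HB (fun _ => y) bot_imp_identity); now left.
  - intros [HB H01] v e [<-|He]; [apply H01|now apply HB]. }
rewrite <- H; split.
- intros HA; apply HA; [apply equational_class_variety|].
  intros B HB; apply H; now apply five_algebras_RDQDStSH1.
- rewrite H; intros [HV H01]; now apply RDQDStSH1_generated.
Qed.

Theorem corollary10p12 :
  (exists E : schemes, is_logic_of E RDQDStSH1) /\
  (forall E : schemes,
     is_logic_of E RDQDStSH1 ->
     is_logic_of
       (adjoin E (fun phi : formula => exists alpha beta : formula,
          phi = (((alpha → beta) → (⊥ → beta)) ⇔H ((alpha → beta) → ⊤))%F))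
       (generated_variety five_algebras)).
Proof.
split.
- exists (identity_schemes RDQDStSH1_identities).
  apply is_logic_of_corresponds, corresponds_models; intros A.
  rewrite models_identity_schemes, <- RDQDStSH1_equational.
  split; [|now intros []]; intros HA; split; trivial; apply HA.
- intros E HE; rewrite is_logic_of_corresponds, corresponds_models in *; intros A.
  rewrite generated_variety_five, HE; split.
  + intros [[HA HEA] H01]; split; trivial.
    intros a [Ha|(alpha & beta & ->)]; [now apply HEA|].
    intros v; cbn; apply iffH_one; auto with lat; now rewrite H01.
  + intros [HA Hadj]; pose proof (DHMSH_semi_Heyting HA) as HS.
    split; [split; trivial; intros a Ha; apply Hadj; now left|].
    intros y; specialize (Hadj _ (or_intror (ex_intro _ (Var 0)
      (ex_intro _ (Var 0) eq_refl))) (fun _ => y)).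
    (* with equal formulas the scheme says [1 ⇒ (0 ⇒ y) = 1 ⇒ 1] *)
    cbn in Hadj; apply (proj1 (iffH_one HS _ _)) in Hadj.
    rewrite !(impxx HS) in Hadj.
    now rewrite <- (meet1x HS (zero ⇒ y)), <- (meet_imp HS), Hadj, (meet1x HS).
Qed.
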